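(* For any forest $T$ and any integer $r \geq 2$, there exists a function $f=f_{T,r}:\mathbb{N}\to\mathbb{N}$ such that for any graph $G$ with $G \stackrel{r}{\to} T$, we have $B(G \stackrel{r}{\to} T;t) \leq f_{T,r}(t)$ for all $t \in \mathbb{N}$.
   Context: All graphs are finite and simple. For graphs $G,H$ and $r\in\mathbb{N}$, write $G \stackrel{r}{\to} H$ if every $r$-colouring of the edges of $G$ contains a monochromatic copy of $H$ (not necessarily induced). For a graph $H$ and $t\in\mathbb{N}$, the $t$-blowup $H[t]$ is obtained from $H$ by replacing each vertex by an independent set of size $t$ and each edge by a complete bipartite graph $K_{t,t}$ between the corresponding parts. A copy of $H[t]$ in $G[n]$ is called canonical if it is the $t$-blowup of a copy of $H$ in $G$; that is, there is a copy $H_0$ of $H$ in $G$ such that the copy of $H[t]$ consists of $t$ vertices chosen from the part of $G[n]$ corresponding to each vertex of $H_0$, together with all edges between the chosen sets for pairs of vertices adjacent in $H_0$. If $G \stackrel{r}{\to} H$, the blowup Ramsey number $B(G \stackrel{r}{\to} H;t)$ is the minimum $n$ such that every $r$-colouring of the edges of $G[n]$ contains a monochromatic canonical copy of $H[t]$. *)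

(* Defs.v *)
From mathcomp Require Import all_boot.

Set Implicit Arguments.
Unset Strict Implicit.
Unset Printing Implicit Defensive.

Record sgraph := SGraph {
  vertex :> finType;
  adj : rel vertex;
  adj_sym : symmetric adj;
  adj_irrefl : irreflexive adj
}.

Definition edges (G : sgraph) : {set {set G}} :=
  [set [set p.1; p.2] | p : G * G & adj p.1 p.2].

Definition edge (G : sgraph) : Type := {e : {set G} | e \in edges G}.

Definition colouring (r : nat) (G : sgraph) : Type := edge G -> 'I_r.

(* [ucycle] also holds of the degenerate sequences [::] and [:: x; y] with
   x, y adjacent, whence the bound on the size. *)
Definition forest (G : sgraph) : Prop :=
  forall s : seq G, ucycle (@adj G) s -> size s <= 2.

(* A copy of H in G is given by an isomorphism from H onto a (not necessarily
   induced) subgraph of G. *)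
Definition embedding (H G : sgraph) (phi : H -> G) : Prop :=
  injective phi /\ (forall x y : H, adj x y -> adj (phi x) (phi y)).

Definition copy_edges (H G : sgraph) (phi : H -> G) : {set {set G}} :=
  [set phi @: (e : {set H}) | e in edges H].

Definition monochromatic (r : nat) (G : sgraph) (c : colouring r G)
    (S : {set {set G}}) : Prop :=
  forall e e' : edge G, val e \in S -> val e' \in S -> c e = c e'.

Definition arrows (G : sgraph) (r : nat) (H : sgraph) : Prop :=
  forall c : colouring r G, exists phi : H -> G,
    embedding phi /\ monochromatic c (copy_edges phi).

Definition blowup_adj (H : sgraph) (t : nat) : rel (H * 'I_t) :=
  fun x y => adj x.1 y.1.

Lemma blowup_sym (H : sgraph) (t : nat) : symmetric (@blowup_adj H t).
Proof. by move=> x y; apply: adj_sym. Qed.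

Lemma blowup_irrefl (H : sgraph) (t : nat) : irreflexive (@blowup_adj H t).
Proof. by move=> x; apply: adj_irrefl. Qed.

Definition blowup (H : sgraph) (t : nat) : sgraph :=
  SGraph (@blowup_sym H t) (@blowup_irrefl H t).

(* The copy psi of H[t] in G[n] places the t vertices of the part of v inside
   the part of phi v, where phi is a copy of H in G. *)
Definition canonical_copy (H G : sgraph) (t n : nat)
    (psi : blowup H t -> blowup G n) : Prop :=
  embedding psi /\
  exists phi : H -> G, embedding phi /\
    (forall x : blowup H t, (psi x).1 = phi x.1).

Definition blowup_arrows (G : sgraph) (r : nat) (H : sgraph) (t n : nat) : Prop :=
  forall c : colouring r (blowup G n),
    exists psi : blowup H t -> blowup G n,
      canonical_copy psi /\ monochromatic c (copy_edges psi).

(* B(G -> H; t) = n, as a relation: n is the minimum of the set of m such that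
   [blowup_arrows G r H t m]; in particular that set is nonempty. *)
Definition is_blowup_ramsey_number (G : sgraph) (r : nat) (H : sgraph)
    (t n : nat) : Prop :=
  blowup_arrows G r H t n /\
  (forall m : nat, blowup_arrows G r H t m -> n <= m).

(* Main.v *)
Require Import Defs.
From mathcomp Require Import all_boot.
From mathcomp Require Import zify.
From Stdlib Require Import Classical.

(* Root T and treat its nodes b from the leaves up, shrinking every part V_v of
   G[n] once per node. A copy S of the subtree below b, hanging at v by an edge,
   is dense at v if many points of the current part of v send many edges of its
   colour to S. Restricting V_v to the points that see a dense S, as long as S
   is not represented by the copies already seen (every small vertex set F
   avoided by S is avoided by one of those), stops after boundedly many steps by
   a skew Bollobas bound; the bound does not depend on G. Then colour each edge
   of G by a majority colour between the final parts. A monochromatic T in this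
   colouring may use copies of subtrees seen by few points only, but node by
   node each can be exchanged for a representative, disjoint from the rest, seen
   by all the points of the part it hangs at. In the resulting copy of T a
   Kovari-Sos-Turan argument from the root down yields T[t]. *)

Set Implicit Arguments.
Unset Strict Implicit.
Unset Printing Implicit Defensive.

(** * Orders of leaf removal in a forest *)

Lemma forest_leaf (T : sgraph) (W : {set T}) :
    forest T -> W != set0 ->
  exists2 a, a \in W &
    {in W &, forall b b', adj a b -> adj a b' -> b = b'}.
Proof.
move=> hT /set0Pn[w Ww].
pose two_nbrs a := [exists b in W, exists b' in W, [&& adj a b, adj a b' & b != b']].
have [/existsP[a /andP[Wa Na]]|/existsPn allW] := boolP [exists a in W, ~~ two_nbrs a].
  exists a => // b b' Wb Wb' ab ab'; apply/eqP/negPn/negP => nbb'.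
  case/negP: Na; apply/existsP; exists b; rewrite Wb.
  by apply/existsP; exists b'; rewrite Wb' ab ab'.
have {}allW a z : a \in W -> exists2 y, y \in W & adj a y && (y != z).
  move=> Wa; have := allW a; rewrite Wa negbK => /existsP[b /andP[Wb /existsP[b']]].
  case/and4P=> Wb' ab ab' nbb'; have [bz|nbz] := eqVneq b z.
    by exists b'; rewrite // ab' -bz eq_sym.
  by exists b; rewrite // ab nbz.
(* If every vertex of [W] had two neighbours in [W], a simple path could be prolonged at its head
   without end: the new vertex avoids the predecessor of the head, and meeting the path elsewhere
   would close a cycle of length at least 3. *)
suff /(_ #|T|)[x [s [sz _ us _]]] : forall n, exists x s,
    [/\ size s = n, x \in W, uniq (x :: s) & path (@adj T) x s].
  by have := max_card [in x :: s]; rewrite (card_uniqP us) /= sz ltnn.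
elim=> [|n [x [s [sz Wx us ps]]]]; first by exists w, [::].
(* For [s] empty the default [x] excludes nothing, since [y] is adjacent to [x]. *)
have [y Wy /andP[xy yz]] := allW x (head x s) Wx.
exists y, (x :: s); split; rewrite /= ?sz // ?[adj y x]adj_sym ?xy //.
rewrite /= in us; rewrite us andbT inE negb_or; apply/andP; split.
  by apply: contraTneq xy => ->; rewrite adj_irrefl.
apply/negP => ys; case/splitPr: ys us ps yz sz => p1 p2 us ps yz _.
have /hT : ucycle (@adj T) (x :: rcons p1 y).
  move: ps us; rewrite -cat_rcons cat_path mem_cat cat_uniq negb_or.
  move=> /andP[ps _] /and3P[/andP[xs _] us _].
  by rewrite /ucycle /= rcons_path ps last_rcons adj_sym xy xs.
by rewrite /= size_rcons; case: p1 yz {us ps} => //=; rewrite eqxx.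
Qed.

(** Leaves are removed one by one and ranked in that order; each has at most one neighbour among the
    vertices that outlive it, which becomes its parent. *)
Lemma forest_rank (T : sgraph) : forest T ->
  exists rk : T -> nat, [/\ injective rk, forall a, rk a < #|T| &
    forall a b b', adj a b -> adj a b' -> rk a < rk b -> rk a < rk b' -> b = b'].
Proof.
move=> hT; suff /(_ _ setT erefl)[rk [inj lt par]] : forall n (W : {set T}), #|W| = n ->
    exists rk : T -> nat, [/\ {in W &, injective rk}, {in W, forall a, rk a < n} &
      {in W & &, forall a b b', adj a b -> adj a b' -> rk a < rk b -> rk a < rk b' -> b = b'}].
  exists rk; split=> [a b|a|a b b']; first exact: inj.
  - by rewrite -cardsT lt.
  - exact: par.
elim=> [|n IHn] W cW.
  move/cards0_eq: cW => ->; exists (fun=> 0).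
  by split=> [a b|a|a b b']; rewrite !inE.
have [|a Wa leaf] := forest_leaf hT (W := W); first by rewrite -card_gt0 cW.
have [|rk [inj lt par]] := IHn (W :\ a).
  by move: cW; rewrite (cardsD1 a) Wa => -[].
exists (fun x => if x == a then 0 else (rk x).+1); split=> [x y Wx Wy|x Wx|x y y' Wx Wy Wy' xy xy'].
- case: (eqVneq x a) (eqVneq y a) => [->|xa] [->|ya] //= [] /inj -> //.
  + by rewrite !inE xa.
  + by rewrite !inE ya.
- by case: eqVneq => // xa; rewrite ltnS lt // !inE xa.
- case: (eqVneq x a) => [xa|xa]; first by move=> _ _; apply: leaf; rewrite -?xa.
  case: (eqVneq y a) (eqVneq y' a) => [->|ya] [->|ya'] //; rewrite !ltnS.
  by apply: par; rewrite // !inE ?xa ?ya ?ya'.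
Qed.

(** * Representative families of sets *)

Definition represented (U : finType) (m : nat) (L : seq {set U}) (S : {set U}) :=
  [forall F : {set U}, (#|F| <= m) && [disjoint S & F] ==>
     has (fun S' : {set U} => [disjoint S' & F]) L].

Fixpoint rep_chain (U : finType) (m : nat) (L : seq {set U}) :=
  if L is S0 :: L' then ~~ represented m L' S0 && rep_chain m L' else true.

Fixpoint chain_bound (k m : nat) : nat :=
  if k is k'.+1 then (m * chain_bound k' m).+1 else 1.

Lemma nrepresentedP (U : finType) m (L : seq {set U}) (S : {set U}) :
  reflect (exists F : {set U}, [/\ #|F| <= m, [disjoint S & F] &
             forall S', S' \in L -> ~~ [disjoint S' & F]])
    (~~ represented m L S).
Proof.
rewrite negb_forall; apply: (iffP existsP) => -[F].
  rewrite negb_imply => /andP[/andP[Fm SF] /hasPn LF].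
  by exists F.
move=> [Fm SF LF]; exists F; rewrite Fm SF negb_imply /=.
exact/hasPn.
Qed.

(** The witness of a set containing [f] avoids [f], so removing [f] from the sets does not change
    which of them it meets. *)
Lemma rep_chain_link (U : finType) m (L : seq {set U}) f : rep_chain m L ->
  rep_chain m [seq X :\ f | X : {set U} <- L & f \in X].
Proof.
elim: L => //= S L IHL /andP[/nrepresentedP[F [Fm SF LF]] /IHL chL].
case: ifP => //= fS; rewrite chL andbT; apply/nrepresentedP; exists F.
have fF : f \notin F by rewrite (disjointFr SF).
split=> // [|S' /mapP[S0]].
  by apply: disjointWl SF; apply: subsetDl.
rewrite mem_filter => /andP[_ /LF S0F] ->; apply: contra S0F.
move=> /pred0P dis; apply/pred0P => x /=; have := dis x; rewrite /= !inE.
by case: eqVneq => //= ->; rewrite (negbTE fF) andbF.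
Qed.

(* Skew Bollobas: the witness F of the last set meets all the others, so some
   f in F lies in a fraction 1/m of them; remove f and induct on k. *)
Lemma rep_chain_size (U : finType) k m (L : seq {set U}) :
    all (fun S : {set U} => #|S| <= k) L -> rep_chain m L ->
  size L <= chain_bound k m.
Proof.
elim: k L => [|k IHk] [|S L] //= /andP[_ Lk] /andP[/nrepresentedP[F [Fm _ LF]] chL].
  (* Sets of size 0 are empty, and an empty set after the first would be disjoint from the witness
     of the first. *)
  case: L Lk LF {chL} => //= S' L /andP[S'0 _] /(_ S'); rewrite inE eqxx => /(_ isT).
  by move: S'0; rewrite leqn0 cards_eq0 => /eqP ->; rewrite disjoints_subset sub0set.
rewrite ltnS.
have le_f f : f \in F -> count (fun S' : {set U} => f \in S') L <= chain_bound k m.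
  move=> _; rewrite -size_filter -(size_map (fun S' : {set U} => S' :\ f)).
  apply: IHk; last exact: rep_chain_link.
  apply/allP => _ /mapP[S' + ->]; rewrite mem_filter => /andP[fS' LS'].
  by have := allP Lk _ LS'; rewrite (cardsD1 f S') fS'.
apply: (@leq_trans (\sum_(f in F) count (fun S' : {set U} => f \in S') L)).
  rewrite {IHk Lk chL le_f}; elim: L LF => //= S' L IHL LF; rewrite big_split /= -add1n leq_add //.
    have /pred0Pn[f /andP[/= fS' fF]] := LF S' (mem_head _ _).
    by rewrite (bigD1 f) //= fS'.
  by apply: IHL => S0 LS0; apply: LF; rewrite inE LS0 orbT.
apply: (@leq_trans (\sum_(f in F) chain_bound k m)); first exact: leq_sum.
by rewrite sum_nat_const leq_mul2r Fm orbT.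
Qed.

(** While some dense [i] is unrepresented, [A] is cut down to [B i] at the cost of a factor [E] and
    [S i] joins the chain; [rep_chain_size] limits the number of cuts. In [grow], [d] bounds the
    cuts still to come. *)
Lemma representative_refinement (V U I : finType) (P : pred I) (S : I -> {set U})
    (B : I -> {set V}) (k m E : nat) (A : {set V}) :
    0 < E -> (forall i, P i -> #|S i| <= k) ->
  exists2 A' : {set V},
    (A' \subset A) && (#|A| <= E ^ chain_bound k m * #|A'|) &
  exists2 L : seq I, {in L, forall j, P j && (A' \subset B j)} &
    forall i, P i -> #|A'| <= E * #|B i :&: A'| ->
    forall F : {set U}, #|F| <= m -> [disjoint S i & F] ->
    exists2 j, j \in L & [disjoint S j & F].
Proof.
move=> E0 Sk.
suff grow : forall d (L : seq I) (A0 : {set V}), {in L, forall j, P j && (A0 \subset B j)} ->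
    rep_chain m (map S L) -> chain_bound k m <= size L + d ->
  exists2 A' : {set V}, (A' \subset A0) && (#|A0| <= E ^ d * #|A'|) &
  exists2 L : seq I, {in L, forall j, P j && (A' \subset B j)} &
    forall i, P i -> #|A'| <= E * #|B i :&: A'| -> represented m (map S L) (S i).
  have [//|//|//|A' subA [L LB rep]] := grow (chain_bound k m) [::] A.
  exists A' => //; exists L => // i Pi dA F Fm SF.
  have /forallP/(_ F) := rep i Pi dA; rewrite Fm SF /= has_map => /hasP[j Lj SjF].
  by exists j.
elim=> [|d IHd] L A0 LB chL; rewrite ?addn0 => szL.
  exists A0; first by rewrite subxx mul1n leqnn.
  exists L => // i Pi _; apply: contraT => nrep.
  have: size (map S (i :: L)) <= chain_bound k m.
    apply: (rep_chain_size (U := U)); last by rewrite /= nrep chL.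
    by apply/allP => _ /mapP[j + ->]; rewrite inE => /orP[/eqP->|/LB/andP[Pj _]]; apply: Sk.
  by rewrite /= size_map ltnNge szL.
pose bad i := [&& P i, #|A0| <= E * #|B i :&: A0| & ~~ represented m (map S L) (S i)].
have [/existsP[i /and3P[Pi dA nrep]]|/existsPn ok] := boolP [exists i, bad i].
  have [|||A' /andP[subA cA] HL] := IHd (i :: L) (B i :&: A0).
  - move=> j; rewrite inE => /orP[/eqP->|/LB/andP[-> sub]]; first by rewrite Pi subsetIl.
    exact: subset_trans (subsetIr _ _) sub.
  - by rewrite /= nrep.
  - by rewrite addSnnS.
  exists A' => //; rewrite (subset_trans subA (subsetIr _ _)) expnS -mulnA /=.
  by apply: leq_trans dA _; rewrite leq_mul2l cA orbT.
exists A0; first by rewrite subxx leq_pmull // expn_gt0 E0.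
exists L => // i Pi dA; have := ok i; rewrite /bad Pi dA /=; exact: contraNT.
Qed.

(** * Dense bipartite graphs *)

Lemma subset_card_exact (V : finType) (X : {set V}) k : k <= #|X| ->
  exists2 X' : {set V}, X' \subset X & #|X'| = k.
Proof.
move=> kX; exists [set x in take k (enum X)].
  by apply/subsetP => x; rewrite inE => /mem_take; rewrite mem_enum.
rewrite cardsE (card_uniqP _) ?take_uniq ?enum_uniq // size_takel //.
by rewrite -cardE.
Qed.

(** Pigeonhole: fix [2 * E * q] points of [X] and sort the points of [Y] by their neighbourhood
    among these. If no neighbourhood of size at least [q] is shared by [q] points, few points of [Y]
    have degree [q] or more, which leaves too few edges. *)
Lemma dense_biclique (V W : finType) (Q : V -> W -> bool) (X : {set V}) (Y : {set W}) E q :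
    0 < E -> 0 < q -> 2 * E * q <= #|X| -> 2 ^ (2 * E * q) * (2 * E * q) < #|Y| ->
    {in X, forall x, #|Y| <= E * #|[set y in Y | Q x y]|} ->
  exists X' : {set V}, exists Y' : {set W},
    [/\ X' \subset X, Y' \subset Y, q <= #|X'|, q <= #|Y'| & {in X' & Y', forall x y, Q x y}].
Proof.
move=> E0 q0 /subset_card_exact[X0 X0X cX0] cY dense.
pose N y := [set x in X0 | Q x y].
have [/existsP[X' /andP[qX' cl]]|/existsPn small] := boolP [exists X' : {set V},
    (q <= #|X'|) && (q <= #|[set y in Y | N y == X']|)].
  exists (X' :&: X0), [set y in Y | N y == X'].
  have sub : X' \subset X0.
    have /card_gt0P[y] := leq_trans q0 cl; rewrite inE => /andP[_ /eqP <-].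
    by apply/subsetP => x; rewrite inE => /andP[].
  rewrite (setIidPl sub) (subset_trans sub) //; split=> //.
    by apply/subsetP => y; rewrite inE => /andP[].
  move=> x y xX'; rewrite inE => /andP[_ /eqP yX'].
  by move: xX'; rewrite -yX' inE => /andP[].
pose Y1 := [set y in Y | q <= #|N y|].
have cY1 : #|Y1| <= 2 ^ (2 * E * q) * q.
  rewrite -sum1_card (partition_big N (mem (powerset X0))) /=; last first.
    by move=> y _; rewrite inE; apply/subsetP => x; rewrite inE => /andP[].
  rewrite -cX0 -card_powerset -sum_nat_const leq_sum // => X' _.
  have := small X'; rewrite negb_and -!ltnNge.
  rewrite sum1dep_card; case/orP => [X'q|/ltnW]; last first.
    apply: leq_trans; rewrite subset_leq_card //; apply/subsetP => y.
    by rewrite !inE => /andP[/andP[-> _]].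
  rewrite (_ : [set _ | _] = set0) ?cards0 //; apply/setP => y; rewrite !inE.
  by apply/negP => /andP[/andP[_ qy] /eqP yX']; move: X'q; rewrite ltnNge -yX' qy.
have dc : \sum_(x in X0) #|[set y in Y | Q x y]| = \sum_(y in Y) #|N y|.
  under eq_bigr do rewrite -sum1dep_card big_mkcondr /=.
  under [RHS]eq_bigr do rewrite -sum1dep_card big_mkcondr /=.
  exact: exchange_big.
have lo : 2 * E * q * #|Y| <= E * \sum_(y in Y) #|N y|.
  rewrite -dc -cX0 -sum_nat_const big_distrr leq_sum //= => x xX0.
  by apply: dense; apply: (subsetP X0X).
have hi : \sum_(y in Y) #|N y| <= q * #|Y| + 2 * E * q * #|Y1|.
  rewrite -[#|Y|]sum1_card -[#|Y1|]sum1dep_card big_mkcondr !big_distrr -big_split /=.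
  rewrite leq_sum // => y _; case: (leqP q #|N y|) => [_|/ltnW]; last by lia.
  rewrite !muln1 -cX0; apply: leq_trans (leq_addl _ _).
  by rewrite subset_leq_card //; apply/subsetP => x; rewrite inE => /andP[].
(* From [lo] and [hi], [q * #|Y| <= 2 * E * q * #|Y1|]; with [cY1] this bounds [#|Y|] by
   [2 ^ (2 * E * q) * (2 * E * q)], against [cY]. *)
exfalso; move: cY; apply/negP; rewrite -leqNgt -(leq_pmul2l q0).
move: lo hi cY1; set S := \sum_(_ in _) _; set P := 2 ^ _; move=> lo hi cY1.
have {}lo : 2 * q * #|Y| <= S by rewrite -(leq_pmul2l E0); lia.
have : 2 * E * q * #|Y1| <= 2 * E * q * (P * q) by rewrite leq_mul2l cY1 orbT.
lia.
Qed.

(** Points outside [D] account for at most half of the guaranteed edges; the other half falls on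
    points of [D], each of degree at most [#|Y|]. *)
Lemma dense_degree (V W : finType) (Q : V -> W -> bool) (X : {set V}) (Y : {set W}) r :
    0 < r -> #|X| * #|Y| <= r * \sum_(x in X) #|[set y in Y | Q x y]| ->
  #|X| <= 2 * r * #|[set x in X | #|Y| <= 2 * r * #|[set y in Y | Q x y]|]|.
Proof.
move=> r0 le_e; set D := [set x in X | _].
have : 2 * r * \sum_(x in X) #|[set y in Y | Q x y]| <= 2 * r * #|Y| * #|D| + #|X| * #|Y|.
  rewrite -[#|X|]sum1_card -[#|D|]sum1dep_card big_mkcondr big_distrl !big_distrr -big_split.
  rewrite leq_sum //= => x _; rewrite mul1n.
  have : #|[set y in Y | Q x y]| <= #|Y|.
    by apply: subset_leq_card; apply/subsetP => y; rewrite inE => /andP[].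
  set d := #|[set y in Y | Q x y]| => dY.
  case: (leqP #|Y| (2 * r * d)) => [_|/ltnW] /=; last by lia.
  by rewrite muln1; apply: leq_trans (leq_addr _ _); rewrite leq_mul2l dY orbT.
set S := \sum_(_ in _) _ in le_e *; move=> hi.
have [Y0|Y0] := posnP #|Y|.
  rewrite (_ : D = X); first by rewrite leq_pmull // muln_gt0.
  by apply/setP => x; rewrite inE Y0 andbT.
by rewrite -(leq_pmul2r Y0); lia.
Qed.

(** * Stages of the shrinking of the parts *)

Section Stages.

Variables (T G : sgraph) (rk : T -> nat) (r n E : nat).
Variable R : 'I_r -> rel (G * 'I_n).
Hypothesis rk_inj : injective rk.

(* [child a b]: b is a child of a; ranks increase towards the root. *)
Definition child (a b : T) : bool := adj a b && (rk b < rk a).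

Definition descendants (b : T) : {set T} := [set a | connect child b a].

Definition nbrs (c : 'I_r) (p : G * 'I_n) (Y : {set 'I_n}) (u : G) : {set 'I_n} :=
  [set y in Y | R c p (u, y)].

(* [A s v] is what is left of the part of v once the nodes of rank < s have been
   treated; points of [A (rk b).+1 v] see a candidate u for b at the stage of b. *)
Definition linked (A : nat -> G -> {set 'I_n}) (c : 'I_r) (b : T) (v u : G) : bool :=
  [forall x in A (rk b).+1 v,
     #|A (rk b) u| <= E * #|nbrs c (v, x) (A (rk b) u) u|].

(** A copy of the subtree at [b] is stored as a total function whose values off [descendants b] are
    ignored, so copies form a finite type. *)
Definition good (A : nat -> G -> {set 'I_n}) (b : T) (c : 'I_r)
    (psi : {ffun T -> G}) : bool :=
  dinjectiveb psi (descendants b) &&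
  [forall a in descendants b, forall a', child a a' ==>
     linked A c a' (psi a) (psi a')].

(** The chain consists of copies together with their colour, whence sets of size [#|T|.+1], and of
    witnesses made of vertices and colours, whence [#|T| + r]. The last clause is the exchange: a
    copy seen by many points gives way to one seen by all, off any small [F]. *)
Definition stage (A : nat -> G -> {set 'I_n}) (s e : nat) : Prop := forall v : G,
  [/\ A s.+1 v \subset A s v,
      #|A s v| <= e ^ chain_bound #|T|.+1 (#|T| + r) * #|A s.+1 v| &
      forall b c (psi : {ffun T -> G}), rk b = s -> good A b c psi ->
      #|A s.+1 v| <= e * #|[set x in A s.+1 v |
          #|A s (psi b)| <= E * #|nbrs c (v, x) (A s (psi b)) (psi b)|]| ->
      forall F : {set G}, #|F| <= #|T| -> [disjoint psi @: descendants b & F] ->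
      exists psi' : {ffun T -> G},
        [/\ good A b c psi', [disjoint psi' @: descendants b & F]
          & linked A c b v (psi' b)]].

Lemma descendants_rank b a : a \in descendants b -> rk a <= rk b.
Proof.
rewrite inE => /connectP[p + ->].
elim: p b => //= x p IHp b /andP[/andP[_ /ltnW xb] /IHp]; lia.
Qed.

Lemma child_descendants b a a' : a \in descendants b -> child a a' -> a' \in descendants b.
Proof. by rewrite !inE => ba /connect1; apply: connect_trans. Qed.

Lemma mem_descendants b : b \in descendants b.
Proof. by rewrite inE. Qed.

Lemma eq_linked A A' c b v u : A (rk b) = A' (rk b) -> A (rk b).+1 = A' (rk b).+1 ->
  linked A c b v u = linked A' c b v u.
Proof. by rewrite /linked => -> ->. Qed.

(** Links inside the subtree at [b] involve [A] only up to index [rk b], so goodness is settled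
    before the stage of [b] begins. *)
Lemma eq_good A A' b c psi : (forall j, j <= rk b -> A j = A' j) ->
  good A b c psi = good A' b c psi.
Proof.
move=> eqA; rewrite /good; congr (_ && _); apply: eq_forallb => a.
have [/descendants_rank ab|//] := boolP (a \in _).
apply: eq_forallb => a'; have [/andP[_ a'a]|//] := boolP (child _ _).
by apply: eq_linked; apply: eqA; lia.
Qed.

Lemma eq_stage A A' s e : (forall j, j <= s.+1 -> A j = A' j) -> stage A s e -> stage A' s e.
Proof.
move=> eqA stA v; have [sub card rep] := stA v.
rewrite -!eqA // in sub card *; split=> // b c psi bs.
have eqg phi : good A' b c phi = good A b c phi.
  by apply: eq_good => j jb; rewrite eqA //; lia.
have eql u : linked A' c b v u = linked A c b v u.
  by apply: eq_linked; rewrite eqA ?bs //.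
rewrite eqg => gpsi dA F Fm dis.
have [psi' [gpsi' dis' lk]] := rep b c psi bs gpsi dA F Fm dis.
by exists psi'; rewrite eqg eql.
Qed.

(** Degrees at stage [s] are counted in the fixed parts [A s], so the part of each [v] can be
    refined independently of the others. *)
Lemma stage_step (A : nat -> G -> {set 'I_n}) s e : 0 < e ->
  exists A', stage (fun j => if j <= s then A j else A') s e.
Proof.
move=> e0.
pose P (i : T * 'I_r * {ffun T -> G}) := (rk i.1.1 == s) && good A i.1.1 i.1.2 i.2.
(* The second component forces a representative to have the same colour: the
   copies of colour c are those avoiding every other colour. *)
pose Sc (D : {set G}) (C : {set 'I_r}) : {set G + 'I_r} := (inl @: D) :|: (inr @: C).
pose S (i : T * 'I_r * {ffun T -> G}) := Sc (i.2 @: descendants i.1.1) [set i.1.2] : {set G + 'I_r}.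
pose B v (i : T * 'I_r * {ffun T -> G}) := [set x | #|A s (i.2 i.1.1)| <=
  E * #|nbrs i.1.2 (v, x) (A s (i.2 i.1.1)) (i.2 i.1.1)|].
have card_Sc D C : #|Sc D C| <= #|D| + #|C|.
  by apply: leq_trans (leq_card_setU _ _) _; rewrite leq_add // leq_imset_card.
have dis_Sc D D' C C' : [disjoint Sc D C & Sc D' C'] = [disjoint D & D'] && [disjoint C & C'].
  apply/idP/andP => [dis|[dD dC]].
    split; apply/pred0P => x /=; apply/negbTE/negP => /andP[xD xD'].
      by have := disjointFr dis (x := inl x); rewrite !inE !imset_f //= => /(_ isT).
    by have := disjointFr dis (x := inr x); rewrite !inE !imset_f ?orbT //= => /(_ isT).
  apply/pred0P => x /=; apply/negbTE/negP; rewrite !inE.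
  case: x => x /andP[/orP[]/imsetP[y yD] // [->] /orP[]/imsetP[z zD] // [yz]].
    by rewrite yz in yD; rewrite (disjointFr dD yD) in zD.
  by rewrite yz in yD; rewrite (disjointFr dC yD) in zD.
have Sk i : P i -> #|S i| <= #|T|.+1.
  move=> _; apply: leq_trans (card_Sc _ _) _; rewrite cards1 addn1 ltnS.
  by apply: leq_trans (leq_imset_card _ _) (max_card _).
have HA v : exists A' : {set 'I_n},
    (A' \subset A s v) && (#|A s v| <= e ^ chain_bound #|T|.+1 (#|T| + r) * #|A'|) /\
    exists2 L : seq (T * 'I_r * {ffun T -> G}),
      {in L, forall j, P j && (A' \subset B v j)} &
    forall i, P i -> #|A'| <= e * #|B v i :&: A'| ->
    forall F : {set G + 'I_r}, #|F| <= #|T| + r -> [disjoint S i & F] ->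
    exists2 j, j \in L & [disjoint S j & F].
  have [A' ? ?] := representative_refinement (B v) (#|T| + r) (A s v) e0 Sk.
  by exists A'.
have [A' HA'] := fin_all_exists HA; exists A' => v; rewrite leqnn ltnn.
have [/andP[-> ->] [L LB rep]] := HA' v; split=> // b c psi bs.
rewrite -(@eq_good A) ?bs; last by move=> j ->.
move=> gpsi dA F Fm dis.
have [||||[[b' c'] psi'] Lj] := rep (b, c, psi) _ _ (Sc F [set~ c]).
- by rewrite /P /= bs eqxx.
- rewrite setIC; apply: leq_trans dA _; rewrite leq_mul2l subset_leq_card ?orbT //.
  by apply/subsetP => x; rewrite !inE.
- apply: leq_trans (card_Sc _ _) _; rewrite leq_add //.
  by rewrite -[leqRHS]card_ord max_card.
- by rewrite dis_Sc dis /= disjoints_subset setCK.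
rewrite dis_Sc /= => /andP[dis' cc'].
have /andP[/andP[/= /eqP bs' gpsi'] /subsetP subB] := LB _ Lj.
have ? : b' = b by apply: rk_inj; rewrite bs'.
have ? : c' = c by apply/set1P; move: cc'; rewrite disjoints_subset setCK sub1set.
subst b' c'; exists psi'; rewrite -(@eq_good A) ?bs; last by move=> j ->.
split=> //; apply/forall_inP => x; rewrite bs leqnn ltnn => /subB.
by rewrite inE.
Qed.

Lemma stages_exist (e : nat -> nat) K : (forall s, 0 < e s) ->
  exists A, A 0 = (fun=> setT) /\ forall s, s < K -> stage A s (e s).
Proof.
move=> e0; elim: K => [|K [A [A0 stA]]]; first by exists (fun _ _ => setT).
have [A' stA'] := stage_step A K (e0 K).
exists (fun j => if j <= K then A j else A'); split=> // s; rewrite ltnS leq_eqVlt.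
case/orP=> [/eqP->//|sK]; apply: eq_stage (stA s sK) => j js.
by rewrite (leq_trans js sK).
Qed.


(** * Exchange of subtrees and blow-up of a linked copy *)

Hypothesis rk_par : forall a b b',
  adj a b -> adj a b' -> rk a < rk b -> rk a < rk b' -> b = b'.

Lemma parent_unique a a' b : child a b -> child a' b -> a = a'.
Proof.
by rewrite /child !(adj_sym _ b) => /andP[ab lt] /andP[a'b lt']; apply: rk_par lt lt'.
Qed.

Lemma parent_descendants a b d : d \in descendants b -> d != b -> child a d ->
  a \in descendants b.
Proof.
rewrite !inE => /connectP[p + ->]; case/lastP: p => [|p d']; first by rewrite eqxx.
rewrite rcons_path last_rcons => /andP[bp cd'] _ /parent_unique/(_ cd') ->.
by apply/connectP; exists p.
Qed.

(** At stage [s] the whole subtree at the vertex of rank [s] is exchanged. Its inner edges are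
    linked as the new copy is good, the edge to the parent by choice of the representative. Vertices
    of larger rank have not moved from [phi], so the density hypothesis still applies to the later
    edges. *)
Lemma relink (A : nat -> G -> {set 'I_n}) (e : nat -> nat) K c (phi : {ffun T -> G}) :
    (forall s, s < K -> stage A s (e s)) -> injective phi ->
    (forall a b, child a b ->
       #|A (rk b).+1 (phi a)| <= e (rk b) * #|[set x in A (rk b).+1 (phi a) |
         #|A (rk b) (phi b)| <=
         E * #|nbrs c (phi a, x) (A (rk b) (phi b)) (phi b)|]|) ->
  exists psi : {ffun T -> G}, [/\ injective psi,
    forall a, K <= rk a -> psi a = phi a &
    forall a b, child a b -> rk b < K -> linked A c b (psi a) (psi b)].
Proof.
move=> + inj_phi dense; elim: K => [|s IHs] stA; first by exists phi; split.
have [|psi [inj_psi eq_psi lk_psi]] := IHs; first by move=> j /ltnW; apply: stA.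
(* With no vertex of rank [s], or a root there, nothing is exchanged. *)
have [/existsP[[a b] /= /andP[/eqP bs ab]]|/existsPn noedge] :=
    boolP [exists p : T * T, (rk p.2 == s) && child p.1 p.2]; last first.
  exists psi; split=> [//|a sa|a b ab]; first by rewrite eq_psi // ltnW.
  rewrite ltnS leq_eqVlt => /orP[bs|/lk_psi-> //].
  by have := noedge (a, b); rewrite /= bs ab.
have rk_ab : s < rk a by move: ab; rewrite /child bs => /andP[].
have aD : a \notin descendants b.
  by apply: contraL rk_ab => /descendants_rank; rewrite bs -leqNgt.
have [_ _ /(_ b c psi bs)] := stA s (leqnn _) (psi a).
rewrite !eq_psi ?bs // ?(ltnW rk_ab) //.
(* The representative avoids the image of the rest of [T], which keeps the glued map injective. *)
case/(_ _ _ (psi @: ~: descendants b)).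
- apply/andP; split; first by apply/dinjectiveP => x y _ _; apply: inj_psi.
  apply/forall_inP => x /descendants_rank xb; apply/forallP => y; apply/implyP => xy.
  by apply: lk_psi => //; case/andP: xy => _ yx; rewrite -bs; apply: leq_trans xb.
- by have := dense a b ab; rewrite bs.
- exact: leq_trans (leq_imset_card _ _) (max_card _).
- apply/pred0P => x /=; apply/negP => /andP[/imsetP[y yD ->] /imsetP[z + /inj_psi yz]].
  by rewrite inE -yz yD.
move=> psi' [/andP[/dinjectiveP inj' /forall_inP lk'] dis lkb].
have sep x y : x \in descendants b -> y \notin descendants b -> psi' x <> psi y.
  move=> xD yD xy; have := disjointFr dis (imset_f psi' xD).
  by rewrite xy imset_f // inE.
exists [ffun x => if x \in descendants b then psi' x else psi x]; split.
- move=> x y; rewrite !ffunE.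
  case: ifPn => xD; case: ifPn => yD; [exact: inj'|by move/sep; case| |exact: inj_psi].
  by move/esym/sep; case.
- move=> x sx; rewrite ffunE ifN ?eq_psi ?(ltnW sx) //.
  by apply: contraL sx => /descendants_rank; rewrite bs -leqNgt.
move=> x y xy ys; rewrite !ffunE.
have [yb|yb] := eqVneq y b.
  rewrite yb in xy *; rewrite (parent_unique xy ab) (negbTE aD) mem_descendants.
  by rewrite eq_psi // ltnW.
have [yD|yD] := boolP (y \in descendants b).
  have xD := parent_descendants yD yb xy; rewrite xD.
  by have /forallP/(_ y)/implyP/(_ xy) := lk' x xD.
rewrite ifN; last by apply: contra yD => /child_descendants; apply.
apply: lk_psi xy _; move: ys; rewrite ltnS leq_eqVlt => /orP[/eqP ys|//].
by case/eqP: yb; apply: rk_inj; rewrite ys.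
Qed.

Lemma nested_le (A : nat -> G -> {set 'I_n}) K i j v :
    (forall s, s < K -> A s.+1 v \subset A s v) -> i <= j <= K -> A j v \subset A i v.
Proof.
move=> subA /andP[]; elim: j => [|j IHj]; first by rewrite leqn0 => /eqP->.
rewrite leq_eqVlt => /orP[/eqP<-//|ij jK].
by apply: subset_trans (subA j jK) _; apply: IHj; rewrite // ltnW.
Qed.

(** Ranks are treated downwards. At rank [j] the parent [a] of [b] has a set of size [w j.+1], all
    of whose points see much of [A j (psi b)]; [dense_biclique] shrinks it to [w j] points and finds
    the set for [b]. Shrinking preserves the edges found earlier. *)
Lemma linked_blowup (A : nat -> G -> {set 'I_n}) K c (psi : T -> G) q :
    0 < E -> 0 < q -> (forall a, rk a < K) ->
    (forall s v, s < K -> A s.+1 v \subset A s v) ->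
    (forall a b, child a b -> linked A c b (psi a) (psi b)) ->
    let Z := (2 * E) ^ K * q in
    (forall s v, s < K -> 2 ^ Z * Z < #|A s v|) ->
  exists X : T -> {set 'I_n}, (forall a, q <= #|X a|) /\
    forall a b x y, child a b -> x \in X a -> y \in X b -> R c (psi a, x) (psi b, y).
Proof.
move=> E0 q0 rkK subA lk Z bigA; pose w j := (2 * E) ^ j * q.
have w0 j : 0 < w j by rewrite muln_gt0 q0 expn_gt0 muln_gt0 E0.
have wS j : w j.+1 = 2 * E * w j by rewrite /w expnS mulnA.
have w_mono j : w j <= w j.+1 by rewrite wS leq_pmull // muln_gt0 E0.
have wZ j : j <= K -> w j <= Z by move=> jK; rewrite leq_mul2r leq_pexp2l ?orbT ?muln_gt0 ?E0.
suff build d j : j + d = K -> exists X : T -> {set 'I_n},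
    [/\ forall a, j <= rk a -> X a \subset A (rk a) (psi a),
      forall a, j <= rk a -> w j <= #|X a| &
      forall a b x y, j <= rk b -> child a b -> x \in X a -> y \in X b ->
        R c (psi a, x) (psi b, y)].
  have [X [_ szX RX]] := build K 0 erefl; exists X; split=> [a|a b x y]; last exact: RX.
  by have := szX a (leq0n _); rewrite /w mul1n.
elim: d j => [|d IHd] j jd.
  have noK a : j <= rk a -> false by have := rkK a; lia.
  by exists (fun=> set0); split=> [a /noK|a /noK|a b x y /noK].
have jK : j < K by lia.
have [|X [subX szX RX]] := IHd j.+1; first lia.
have [/existsP[b /eqP bj]|/existsPn noj] := boolP [exists b, rk b == j]; last first.
  have jS a : j <= rk a -> j < rk a by have := noj a; rewrite ltn_neqAle eq_sym => ->.
  exists X; split=> [a /jS/subX|a /jS/szX|a b x y /jS]//; last exact: RX.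
  exact: leq_trans.
have jS x : x != b -> j <= rk x -> j < rk x.
  move=> xb jx; rewrite ltn_neqAle jx andbT; apply: contra xb => /eqP jx'.
  by apply/eqP/rk_inj; rewrite bj.
have big_b : 2 ^ w j.+1 * w j.+1 < #|A j (psi b)|.
  apply: leq_ltn_trans (bigA j (psi b) jK).
  by rewrite leq_mul ?leq_exp2l ?wZ.
(* A root has no edge to an earlier set and receives its whole part. *)
have [/existsP[a ab]|/existsPn nopar] := boolP [exists a, child a b]; last first.
  exists (fun x => if x == b then A j (psi b) else X x); split.
  - by move=> x; case: eqVneq => [-> _|xb /(jS _ xb)/subX//]; rewrite bj.
  - move=> x; case: eqVneq => [_ _|xb /(jS _ xb)/szX]; last exact: leq_trans.
    apply: leq_trans (w_mono j) (leq_trans _ (ltnW big_b)).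
    by rewrite leq_pmull // expn_gt0.
  - move=> x y x' y' jy xy; case: eqVneq => [xb|_].
      by move: xy; rewrite /child xb bj ltnNge jy andbF.
    case: eqVneq => [yb|yb]; first by move: (nopar x); rewrite -yb xy.
    exact: RX (jS _ yb jy) xy.
have ja : j < rk a by move: ab; rewrite /child bj => /andP[].
have neq_ab : a != b by apply: contraTneq ja => ->; rewrite bj ltnn.
have subXa : X a \subset A j.+1 (psi a).
  apply: subset_trans (subX a ja) _; apply: (@nested_le A K); last by rewrite ja ltnW.
  by move=> s; apply: subA.
have [|||X' [Y' [subX' subY' szX' szY' RXY]]] := @dense_biclique _ _
    (fun x y => R c (psi a, x) (psi b, y)) (X a) (A j (psi b)) E (w j) E0 (w0 j).
- by rewrite -wS szX.
- by rewrite -wS.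
- move=> x /(subsetP subXa) xA.
  by have /forall_inP := lk a b ab; rewrite bj => /(_ x xA).
pose X1 x := if x == b then Y' else if x == a then X' else X x.
have X1sub x : x != b -> X1 x \subset X x.
  by rewrite /X1 => /negbTE ->; case: eqVneq => // ->.
exists X1; split.
- move=> x; case: (eqVneq x b) => [-> _|xb jx]; first by rewrite /X1 eqxx bj.
  exact: subset_trans (X1sub x xb) (subX x (jS x xb jx)).
- move=> x; rewrite /X1; case: (eqVneq x b) => // xb jx; case: eqVneq => // _.
  exact: leq_trans (w_mono j) (szX x (jS x xb jx)).
- move=> x y x' y' jy xy.
  have xb : x != b by apply: contraTneq xy => ->; rewrite /child bj ltnNge jy andbF.
  have [yb|yb] := eqVneq y b.
    move: xy; rewrite yb => /parent_unique/(_ ab) ->.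
    by rewrite /X1 (negbTE neq_ab) !eqxx; apply: RXY.
  move=> /(subsetP (X1sub x xb)) x'X /(subsetP (X1sub y yb)) y'X.
  exact: RX (jS y yb jy) xy x'X y'X.
Qed.

End Stages.

(** * Edges and their colours *)

Lemma set2_eq (V : finType) (x y u v : V) : [set x; y] = [set u; v] ->
  x = u /\ y = v \/ x = v /\ y = u.
Proof.
move=> eq_xy; have /set2P xuv : x \in [set u; v] by rewrite -eq_xy set21.
have /set2P yuv : y \in [set u; v] by rewrite -eq_xy set22.
have /set2P uxy : u \in [set x; y] by rewrite eq_xy set21.
have /set2P vxy : v \in [set x; y] by rewrite eq_xy set22.
by case: xuv yuv uxy vxy => [?|?] [?|?] [?|?] [?|?]; subst; auto.
Qed.

Lemma mem_edges (G : sgraph) (x y : G) : ([set x; y] \in edges G) = adj x y.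
Proof.
apply/imsetP/idP => [[[u v]]|xy]; last by exists (x, y); rewrite ?inE.
rewrite inE /= => uv /set2_eq eq_xy.
by case: eq_xy => -[-> ->]; rewrite // adj_sym.
Qed.

Section Colouring.

Variables (G : sgraph) (r : nat) (chi : colouring r G).

Definition has_colour (c : 'I_r) (x y : G) : bool :=
  if insub [set x; y] is Some e then chi e == c else false.

Lemma has_colour_sym c x y : has_colour c x y = has_colour c y x.
Proof. by rewrite /has_colour setUC. Qed.

Lemma has_colourP c x y :
  reflect (exists2 e : edge G, val e = [set x; y] & chi e = c) (has_colour c x y).
Proof.
rewrite /has_colour; case: insubP => [e _ eq_e|nxy].
  apply: (iffP eqP) => [ec|[e' eq_e' <-]]; first by exists e.
  by congr chi; apply: val_inj; rewrite eq_e eq_e'.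
by constructor=> -[e eq_e _]; case/negP: nxy; rewrite -eq_e; apply: valP.
Qed.

Lemma has_colour_adj c x y : has_colour c x y -> adj x y.
Proof. by case/has_colourP => e eq_e _; rewrite -mem_edges -eq_e; apply: valP. Qed.

Lemma adj_has_colour x y : adj x y -> exists c, has_colour c x y.
Proof.
rewrite -mem_edges => xy; pose e : edge G := exist (fun e => is_true (e \in edges G)) _ xy.
by exists (chi e); apply/has_colourP; exists e.
Qed.

Lemma mono_colour (H : sgraph) (phi : H -> G) : 0 < r -> embedding phi ->
    monochromatic chi (copy_edges phi) ->
  exists c, forall a b, adj a b -> has_colour c (phi a) (phi b).
Proof.
move=> r0 [_ adj_phi] mono.
have in_copy a b : adj a b -> [set phi a; phi b] \in copy_edges phi.
  by move=> ab; apply/imsetP; exists [set a; b]; rewrite ?mem_edges // imsetU1 imset_set1.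
have [/existsP[[a b] /= ab]|/existsPn noadj] := boolP [exists p : H * H, adj p.1 p.2].
  have [c /has_colourP[e eq_e ec]] := adj_has_colour (adj_phi a b ab).
  exists c => a' b' ab'; have [c' /has_colourP[e' eq_e' ec']] := adj_has_colour (adj_phi _ _ ab').
  apply/has_colourP; exists e' => //; rewrite -ec; apply: mono.
    by rewrite eq_e' in_copy.
  by rewrite eq_e in_copy.
(* [H] has no edges here, so any colour serves. *)
by exists (Ordinal r0) => a b ab; have := noadj (a, b); rewrite /= ab.
Qed.

Lemma colour_mono (H : sgraph) (phi : H -> G) c :
    (forall a b, adj a b -> has_colour c (phi a) (phi b)) ->
  monochromatic chi (copy_edges phi).
Proof.
move=> col; have get e : val e \in copy_edges phi -> chi e = c.
  case/imsetP => _ /imsetP[[a b] /= + ->]; rewrite inE /= imsetU1 imset_set1 => ab eq_e.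
  have /has_colourP[e' eq_e' <-] := col a b ab.
  by congr chi; apply: val_inj; rewrite /= eq_e -eq_e'.
by move=> e e' /get-> /get->.
Qed.

End Colouring.

(* Bounds the ratio of a part to its final size when j stages remain: a part
   loses a factor 2rM at most N times in a stage, where M bounds the loss in the
   stages after it. *)
Fixpoint shrink_factor (r N j : nat) : nat :=
  if j is j'.+1 then (2 * r * shrink_factor r N j') ^ N * shrink_factor r N j' else 1.

Lemma shrink_factor_gt0 r N j : 0 < r -> 0 < shrink_factor r N j.
Proof. by move=> r0; elim: j => //= j IHj; rewrite muln_gt0 expn_gt0 !muln_gt0 r0 IHj. Qed.

Lemma shrink_factor_mono r N i j : 0 < r -> i <= j ->
  shrink_factor r N i <= shrink_factor r N j.
Proof.
move=> r0; elim: j => [|j IHj]; first by rewrite leqn0 => /eqP->.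
rewrite leq_eqVlt => /orP[/eqP->//|/IHj/leq_trans]; apply=> /=.
by rewrite leq_pmull // expn_gt0 !muln_gt0 r0 shrink_factor_gt0.
Qed.

(** * Majority colours between the parts *)

Section CommonParts.

Variables (G : sgraph) (r n : nat) (chi : colouring r (blowup G n)).
Variable W : G -> {set 'I_n}.

Definition pair_count (c : 'I_r) (u v : G) : nat :=
  \sum_(x in W u) #|[set y in W v | has_colour chi c (u, x) (v, y)]|.

Definition dense_pair (c : 'I_r) (u v : G) : bool :=
  #|W u| * #|W v| <= r * pair_count c u v.

Lemma dense_pair_sym c u v : dense_pair c u v = dense_pair c v u.
Proof.
rewrite /dense_pair /pair_count mulnC; congr (_ <= _ * _).
under eq_bigr do rewrite -sum1dep_card big_mkcondr /=.
under [RHS]eq_bigr do rewrite -sum1dep_card big_mkcondr /=.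
rewrite exchange_big; apply: eq_bigr => y _; apply: eq_bigr => x _.
by rewrite has_colour_sym.
Qed.

Lemma exists_dense_pair u v : 0 < r -> adj u v -> exists c, dense_pair c u v.
Proof.
move=> r0 uv; apply/existsP; apply: contraT => /existsPn sparse.
(* Every pair of points has a colour, so the [r] counts add up to at least the product of the sizes;
   if each fell short of its share, the sum would too. *)
have le_c (c : 'I_r) : r * pair_count c u v <= (#|W u| * #|W v|).-1.
  by have := sparse c; rewrite /dense_pair -ltnNge; case: (_ * #|_|).
have gt0 : 0 < #|W u| * #|W v| by have := sparse (Ordinal r0); rewrite /dense_pair; case: (_ * #|_|).
have : #|W u| * #|W v| <= \sum_c pair_count c u v.
  rewrite exchange_big -sum_nat_const leq_sum //= => x _.
  under eq_bigr do rewrite -sum1dep_card big_mkcondr /=.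
  rewrite exchange_big -sum1_card leq_sum //= => y _.
  have [c col] : exists c, has_colour chi c (u, x) (v, y) by apply: adj_has_colour.
  by rewrite (bigD1 c) //= col.
rewrite -(leq_pmul2l r0) big_distrr /= => /leq_trans/(_ (leq_sum _ (fun c _ => le_c c))).
by rewrite sum_nat_const card_ord leq_pmul2l // leqNgt ltn_predL gt0.
Qed.

Lemma dense_colouring : 0 < r -> exists col : colouring r G,
  forall c u v, has_colour col c u v -> dense_pair c u v.
Proof.
move=> r0.
pose P (e : edge G) (c : 'I_r) :=
  [forall u, forall v, (val e == [set u; v]) ==> dense_pair c u v].
(* The default is never taken: each edge has a dense colour, valid in both orientations by
   [dense_pair_sym]. *)
pose col e := odflt (Ordinal r0) [pick c | P e c].
exists col => c u v /has_colourP[e eq_e].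
rewrite /col; case: pickP => [c' /forallP/(_ u)/forallP/(_ v)|noc _].
  by rewrite eq_e eqxx => /= d <-.
have uv : adj u v by rewrite -mem_edges -eq_e; apply: valP.
have [c' d] := exists_dense_pair r0 uv; case/negP: (noc c').
apply/forallP => u'; apply/forallP => v'; apply/implyP; rewrite eq_e.
by move=> /eqP/set2_eq eq_uv; case: eq_uv d => -[-> ->]; rewrite // dense_pair_sym.
Qed.

End CommonParts.

(** * The bound and the assembly of the proof *)

Section ForestBlowup.

Variables (T : sgraph) (r : nat).

Let N := chain_bound #|T|.+1 (#|T| + r).
Let M := shrink_factor r N.
Let E := 2 * r * M #|T|.
Let Z t := (2 * E) ^ #|T| * t.+1.

(** Final parts keep a fraction [1 / M #|T|] of their points, so more than [2 ^ Z t * Z t] survive,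
    as [linked_blowup] asks. The [t.+1] in [Z] makes the chosen sets nonempty even for [t = 0]. *)
Definition blowup_bound (t : nat) : nat := M #|T| * (2 ^ Z t * Z t).+1.

Lemma forest_blowup_arrows (G : sgraph) t : forest T -> 0 < r -> arrows G r T ->
  blowup_arrows G r T t (blowup_bound t).
Proof.
move=> hT r0 arr chi; set K := #|T|; set n := blowup_bound t.
have M0 j : 0 < M j by apply: shrink_factor_gt0.
have E0 : 0 < E by rewrite !muln_gt0 r0 M0.
have [rk [rk_inj rkK rk_par]] := forest_rank hT.
(* Majority colours are dense in the final parts: [2 * r] comes from [dense_degree], and
   [M (K - s.+1)] pays for comparing [A s.+1] with [A K]. *)
pose e s := 2 * r * M (K - s.+1).
have e0 s : 0 < e s by rewrite !muln_gt0 r0 M0.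
pose R c p q := has_colour chi c p q.
have [A [A0 stA]] := @stages_exist T G rk r n E R rk_inj e K e0.
have subA s v : s < K -> A s.+1 v \subset A s v by move/stA => /(_ v)[].
have szA j v : j <= K -> #|A (K - j) v| <= M j * #|A K v|.
  elim: j => [|j IHj] jK; first by rewrite subn0 mul1n.
  have jK' : K - j.+1 < K by lia.
  have eq_j : (K - j.+1).+1 = K - j by lia.
  have [_ + _] := stA _ jK' v; rewrite /e eq_j subKn -/N; last exact: ltnW.
  move/leq_trans; apply; rewrite [M j.+1]/(_ * M j) -[leqRHS]mulnA leq_mul2l IHj ?orbT //.
  exact: ltnW.
have szA' s v : s <= K -> #|A s v| <= M (K - s) * #|A K v|.
  by move=> sK; rewrite -{1}(subKn sK) szA // leq_subr.
have [col dense_col] := dense_colouring chi (A K) r0.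
have [phi [emb_phi mono_phi]] := arr col.
have [c col_phi] := mono_colour r0 emb_phi mono_phi.
case: emb_phi => inj_phi _.
have [|a b ab|psi [inj_psi _ lk_psi]] := @relink T G rk r n E R rk_inj rk_par A e K c (finfun phi) stA.
- by move=> x y; rewrite !ffunE; apply: inj_phi.
- rewrite !ffunE; have bK : rk b < K := rkK b.
  have /andP[adj_ab _] := ab.
  (* Points are compared between [A (rk b).+1] and [A K] through [e]; degrees, counted in
     [A (rk b)], cost at most the factor [M K] contained in [E]. *)
  have /(dense_degree r0) dK := dense_col c _ _ (col_phi a b adj_ab).
  apply: leq_trans (szA' _ _ bK) _.
  apply: leq_trans (leq_mul (leqnn _) dK) _.
  rewrite mulnCA mulnA leq_mul // subset_leq_card //; apply/subsetP => x.
  rewrite inE => /andP[xK deg_x]; rewrite inE; apply/andP; split.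
    by apply: (subsetP _ x xK); apply: (@nested_le _ _ A K) => [s|]; [apply: subA|rewrite bK leqnn].
  apply: leq_trans (szA' _ _ (ltnW bK)) _.
  apply: leq_trans (leq_mul (shrink_factor_mono N r0 (leq_subr _ _)) deg_x) _.
  rewrite mulnCA mulnA leq_mul // subset_leq_card //; apply/subsetP => y.
  rewrite !inE => /andP[yK Rxy]; apply/andP; split=> //.
  by apply: (subsetP _ y yK); apply: (@nested_le _ _ A K) => [s|]; [apply: subA|rewrite leqnn ltnW].
have [|s v sK|X [szX RX]] := @linked_blowup T G rk r n E R rk_inj rk_par A K c psi t.+1 E0 (ltn0Sn _) rkK subA.
- by move=> a b ab; apply: lk_psi.
- apply: (@leq_trans #|A K v|); last first.
    by apply/subset_leq_card/(@nested_le _ _ A K) => [s'|]; [apply: subA|rewrite leqnn ltnW].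
  have := szA' 0 v (leq0n _); rewrite A0 cardsT card_ord subn0 /n /blowup_bound.
  by rewrite leq_pmul2l.
pose g (p : blowup T t) : blowup G n :=
  (psi p.1, enum_val (widen_ord (ltnW (szX p.1)) p.2)).
have col_g p q : adj p q -> has_colour chi c (g p) (g q).
  move=> pq; have : rk p.1 != rk q.1.
    by apply: contraTneq pq => /rk_inj; rewrite /adj /= /blowup_adj => ->; rewrite adj_irrefl.
  rewrite neq_ltn => /orP[lt|lt].
    by rewrite has_colour_sym; apply: RX; rewrite ?enum_valP // /child lt adj_sym andbT.
  by apply: RX; rewrite ?enum_valP // /child lt andbT.
exists g; split; last exact: colour_mono col_g.
split; first split=> [[a i] [b j] []|p q /col_g/has_colour_adj //].
  by move=> /inj_psi eq_ab; subst b => /enum_val_inj/(congr1 val) /= /val_inj ->.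
exists psi; split=> //; split=> // a b ab.
(* Adjacency of [psi a] and [psi b] in [G] is read off a coloured edge between points of their
   chosen sets. *)
have [x xX] : exists x, x \in X a by apply/card_gt0P; apply: leq_trans (szX a).
have [y yX] : exists y, y \in X b by apply/card_gt0P; apply: leq_trans (szX b).
have : rk a != rk b by apply: contraTneq ab => /rk_inj ->; rewrite adj_irrefl.
rewrite neq_ltn => /orP[lt|lt].
  rewrite adj_sym; apply: (@has_colour_adj _ _ chi c (psi b, y) (psi a, x)).
  by apply: RX => //; rewrite /child lt adj_sym andbT.
apply: (@has_colour_adj _ _ chi c (psi a, x) (psi b, y)).
by apply: RX => //; rewrite /child lt andbT.
Qed.

End ForestBlowup.

(** Classical, since [P] is an arbitrary proposition. *)
Lemma ex_least (P : nat -> Prop) n : P n ->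
  exists m, (P m /\ forall k, P k -> m <= k) /\ m <= n.
Proof.
elim/ltn_ind: n => n IHn Pn.
have [[k [kn Pk]]|least] := classic (exists k, k < n /\ P k).
  have [m [Pm mk]] := IHn k kn Pk; exists m; split=> //; lia.
exists n; split=> //; split=> // k Pk; rewrite leqNgt; apply/negP => kn.
by apply: least; exists k.
Qed.

Theorem theorem1p6 (T : sgraph) (hT : forest T) (r : nat) (hr : 2 <= r) :
  exists f : nat -> nat,
    forall G : sgraph, arrows G r T ->
      forall t : nat,
        exists n : nat, is_blowup_ramsey_number G r T t n /\ n <= f t.
Proof.
exists (blowup_bound T r) => G arr t.
exact: ex_least (forest_blowup_arrows (t := t) hT (ltnW hr) arr).
Qed.
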